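(* Let $\mathcal{P}$ be a partition of $\omega$ into infinitely many infinite sets. If $\mathcal{A}$ is a completely separable $NMAD$-family on $\omega$ of size $\mathfrak{c}$, then $S_{\mathcal{P}}\nleq_{TU}S_{\mathcal{A}}$ and $S_{\mathcal{P}}\leq_{RK}S_{\mathcal{A}}$.
   Context: All filters are proper free filters on $\omega$ (they contain all cofinite sets). $A\subseteq^* B$ means $A\setminus B$ is finite. An $AD$-family is an infinite family of infinite subsets of $\omega$ any two distinct members of which have finite intersection. For an $AD$-family $\mathcal{A}$, $\mathcal{I}(\mathcal{A})=\{X\subseteq\omega:\exists\text{ finite }\mathcal{A}'\subseteq\mathcal{A}\ (X\subseteq^*\bigcup\mathcal{A}')\}$ and $S_{\mathcal{A}}=\{\omega\setminus I:I\in\mathcal{I}(\mathcal{A})\}$. An $AD$-family $\mathcal{A}$ is an $NMAD$-family (nowhere $MAD$) if every $X\subseteq\omega$ with $X\notin\mathcal{I}(\mathcal{A})$ contains an infinite set $B$ such that $B\cap I$ is finite for every $I\in\mathcal{I}(\mathcal{A})$. $\mathcal{A}^*$ is the set of infinite $M\subseteq\omega$ for which $\{A\in\mathcal{A}:|A\cap M|=\omega\}$ is infinite; $\mathcal{A}$ is completely separable if for every $M\in\mathcal{A}^*$ there is $A\in\mathcal{A}$ with $A\subseteq M$. For a filter $\mathcal{F}$, $\mathcal{F}^+$ is the set of $A\subseteq\omega$ meeting every element of $\mathcal{F}$, and for $A\in\mathcal{F}^+$, $\mathcal{F}|_A=\{F\cap A:F\in\mathcal{F}\}$. For a function $f:A\to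 B$ and a filter $\mathcal{H}$ on $A$, $f[\mathcal{H}]=\{X\subseteq B:f^{-1}(X)\in\mathcal{H}\}$. $\mathcal{F}\leq_{RK}\mathcal{G}$ means there is a surjection $f:\omega\to\omega$ with $f[\mathcal{G}]=\mathcal{F}$. $\mathcal{F}\leq_{TU}\mathcal{G}$ means there are $A\in\mathcal{G}^+$, $B\in\mathcal{F}$ and a bijection $f:A\to B$ with $f[\mathcal{G}|_A]=\mathcal{F}|_B$; by convention the witnessing set $B$ is always taken to be $\omega$, i.e. there are $A\in\mathcal{G}^+$ and a bijection $f:A\to\omega$ with $f[\mathcal{G}|_A]=\mathcal{F}$. *)

(* Defs.v *)
From mathcomp Require Import all_boot.
From mathcomp Require Export boolp classical_sets functions cardinality filter.

Set Implicit Arguments.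
Unset Strict Implicit.
Unset Printing Implicit Defensive.

Local Open Scope classical_set_scope.

Definition almost_subset (X Y : set nat) : Prop := finite_set (X `\` Y).

Definition AD_family (A : set_system nat) : Prop :=
  [/\ infinite_set A,
      forall X, A X -> infinite_set X
    & forall X Y, A X -> A Y -> X <> Y -> finite_set (X `&` Y)].

Definition ideal_of (A : set_system nat) : set_system nat :=
  [set X | exists A' : set_system nat,
     [/\ A' `<=` A, finite_set A' & almost_subset X (\bigcup_(Y in A') Y)]].

Definition filter_of (A : set_system nat) : set_system nat :=
  [set ~` I | I in ideal_of A].

Definition NMAD_family (A : set_system nat) : Prop :=
  AD_family A /\
  forall X : set nat, ~ ideal_of A X ->
    exists B : set nat, [/\ B `<=` X, infinite_set B
      & forall I, ideal_of A I -> finite_set (B `&` I)].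

(* The family written A^* in the literature. *)
Definition star_of (A : set_system nat) : set_system nat :=
  [set M | infinite_set M /\
     infinite_set [set X | A X /\ infinite_set (X `&` M)]].

Definition completely_separable (A : set_system nat) : Prop :=
  forall M, star_of A M -> exists2 X, A X & X `<=` M.

Definition has_size_continuum (A : set_system nat) : Prop :=
  (A #= [set: set nat])%card.

Definition positive (F : set_system nat) : set_system nat :=
  [set A | forall X, F X -> A `&` X !=set0].

Definition restriction (F : set_system nat) (A : set nat) : set_system nat :=
  [set X `&` A | X in F].

(* The image f[H] of a filter H on A under a map f : A -> nat.  Such a map is
   represented by a total f : nat -> nat whose values outside A are ignored. *)
Definition image_from (A : set nat) (f : nat -> nat) (H : set_system nat)
  : set_system nat := [set X | H (A `&` f @^-1` X)].

Definition le_RK (F G : set_system nat) : Prop :=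
  exists f : nat -> nat, set_surj setT setT f /\ fmap f G = F.

(* The witnessing set on the side of F is taken to be the whole of nat. *)
Definition le_TU (F G : set_system nat) : Prop :=
  exists A : set nat, positive G A /\
  exists f : nat -> nat,
    set_bij A setT f /\ image_from A f (restriction G A) = F.

Definition partition_into_infinite_sets (P : set_system nat) : Prop :=
  [/\ partition P id [set: nat], infinite_set P
    & forall X, P X -> infinite_set X].

(* Main.v *)
Require Import Defs.
From mathcomp Require Import all_boot.
From mathcomp Require Import boolp classical_sets functions cardinality filter.

(* The ideal of the partition consists of the sets meeting only finitely many
   blocks.

   S_P </=_TU S_A: a witness is a set B together with a bijection from B onto
   omega; it transports P to a partition of B into infinite sets q(Q) generating
   the trace on B of the ideal of A.  Each q(Q) has infinite intersection with
   some member c(Q) of A, and Q |-> c(Q) is finite-to-one.  Choose H(Q) inside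
   c(Q) /\ q(Q), infinite and with infinite complement there.  The union M of
   the H(Q) is in A^*, yet a member Y of A inside M meets only finitely many
   q(Q), hence some H(Q) in an infinite set, so Y = c(Q), which is not
   contained in M.

   S_P <=_RK S_A: take distinct members a_0, a_1, ... of A, make a_n + {n}
   disjoint to get a partition of omega into infinite sets, and map the n-th
   piece onto the n-th block of P with infinite fibres. *)

Set Implicit Arguments.
Unset Strict Implicit.
Unset Printing Implicit Defensive.

Local Open Scope classical_set_scope.

Lemma finite_set_split (T : Type) (X Y : set T) :
  finite_set (X `&` Y) -> finite_set (X `\` Y) -> finite_set X.
Proof. by move=> fI fD; rewrite -(setUIDK X Y) finite_setU. Qed.

Lemma exists_infinite_fibers (R P : set nat) : infinite_set R -> P !=set0 ->
  exists g : nat -> nat, (forall x, P (g x)) /\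
    forall p, P p -> infinite_set (R `&` g @^-1` [set p]).
Proof.
move=> infR [p0 Pp0].
have /card_set_bijP[h [_ _ hsurj]] : (R #= [set: nat * nat])%card.
  apply: card_eq_trans (eq_card_nat (countableP _) infR) _.
  by rewrite card_eq_sym card_nat2.
exists (fun x => if `[< P (h x).1 >] then (h x).1 else p0); split=> [x|p Pp fin].
  by case: asboolP.
apply: infinite_nat; apply: sub_finite_set (finite_image (fun x => (h x).2) fin).
move=> k _; have [x Rx hx] := hsurj (p, k) I; exists x; last by rewrite hx.
by split=> //=; rewrite hx; case: asboolP.
Qed.

Lemma infinite_split (R : set nat) : infinite_set R ->
  exists H, [/\ H `<=` R, infinite_set H & infinite_set (R `\` H)].
Proof.
move=> infR; have [|g [_ gP]] := @exists_infinite_fibers R [set x | x < 2] infR.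
  by exists 0.
exists (R `&` g @^-1` [set 0]); split; [exact: subIsetl | exact: gP |].
apply: sub_infinite_set (gP 1 isT) => x [Rx gx]; split=> // -[_].
by rewrite /= gx.
Qed.

Lemma ideal_of_sub (A : set_system nat) (X Y : set nat) :
  X `<=` Y -> ideal_of A Y -> ideal_of A X.
Proof.
move=> XY [A' [A'A fA' fY]]; exists A'; split=> //.
by apply: sub_finite_set fY; apply: setSD.
Qed.

Lemma ideal_of_mem (A : set_system nat) (X : set nat) : A X -> ideal_of A X.
Proof.
move=> AX; exists [set X]; split; [by move=> _ -> | exact: finite_set1 |].
by rewrite /almost_subset bigcup_set1 setDv; exact: finite_set0.
Qed.

Lemma ideal_of_infinite_trace (A : set_system nat) (X : set nat) :
  ideal_of A X -> infinite_set X -> exists2 Y, A Y & infinite_set (Y `&` X).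
Proof.
move=> [A' [A'A fA' fX]] infX; apply: contrapT => noY; apply: infX.
apply: finite_set_split fX; rewrite setI_bigcupr; apply: bigcup_finite => // Y A'Y.
by rewrite setIC; apply: contrapT => ?; apply: noY; exists Y => //; apply: A'A.
Qed.

Lemma AD_ideal_finite_trace (A : set_system nat) (X : set nat) :
  AD_family A -> ideal_of A X -> finite_set [set Y | A Y /\ infinite_set (Y `&` X)].
Proof.
move=> [_ _ AD] [A' [A'A fA' fX]]; apply: (sub_finite_set _ fA') => Y [AY infYX].
apply: contrapT => A'Y; apply: infYX.
apply: (@finite_set_split _ _ (\bigcup_(Z in A') Z)); last first.
  by apply: sub_finite_set fX => x [[_ Xx] nx].
apply: (@sub_finite_set _ _ (\bigcup_(Z in A') (Y `&` Z))).
  by move=> x [[Yx _] [Z A'Z Zx]]; exists Z.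
apply: bigcup_finite => // Z A'Z; apply: AD => //; first exact: A'A.
by move=> YZ; apply: A'Y; rewrite YZ.
Qed.

Lemma ideal_of_partition (P : set_system nat) (X : set nat) :
  partition_into_infinite_sets P ->
  ideal_of P X <-> finite_set [set Y | P Y /\ Y `&` X !=set0].
Proof.
move=> [[cov triv _] _ _]; split=> [[A' [A'P fA' fX]]|fX]; last first.
  exists [set Y | P Y /\ Y `&` X !=set0]; split=> [Y []//|//|].
  rewrite /almost_subset (_ : X `\` _ = set0); first exact: finite_set0.
  rewrite -subset0 => x [Xx]; apply.
  have [Y PY Yx] : (\bigcup_(Y in P) Y) x by rewrite [\bigcup_(_ in _) _]cov.
  by exists Y => //; split=> //; exists x.
rewrite /almost_subset in fX; set D := X `\` _ in fX.
apply: (@sub_finite_set _ _ (A' `|` \bigcup_(d in D) [set Y | P Y /\ Y d])).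
  move=> Y [PY [x [Yx Xx]]]; have [[Z A'Z Zx]|nx] := pselect ((\bigcup_(Z in A') Z) x).
    by left; rewrite (triv Y Z) //; [exact: A'P | exists x].
  by right; exists x.
rewrite finite_setU; split; first exact: fA'.
apply: bigcup_finite; [exact: fX | move=> d _].
have [[Y [PY Yd]]|noY] := pselect (exists Y, P Y /\ Y d); last first.
  rewrite (_ : [set _ | _] = set0); first exact: finite_set0.
  by rewrite -subset0 => Y ?; apply: noY; exists Y.
apply: sub_finite_set (finite_set1 Y) => Z [PZ Zd].
by apply: triv => //; exists d.
Qed.

Lemma filter_of_setC (A : set_system nat) (X : set nat) :
  filter_of A (~` X) <-> ideal_of A X.
Proof.
split=> [[I AI /(congr1 (@setC _))]|AX]; last by exists X.
by rewrite !setCK => <-.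
Qed.

Lemma partition_not_le_TU (P A : set_system nat) :
  partition_into_infinite_sets P -> AD_family A -> completely_separable A ->
  ~ le_TU (filter_of P) (filter_of A).
Proof.
move=> hP hA hsep [B [_ [f [[_ finj fsurj] fE]]]].
have idealE Z : ideal_of P Z <-> ideal_of A (B `&` f @^-1` Z).
  rewrite -filter_of_setC -fE; split=> [[_ [I AI <-] /seteqP[IB _]]|AI].
    apply: ideal_of_sub AI => x [Bx Zx]; apply: contrapT => nIx.
    by have [_] := IB x (conj nIx Bx).
  exists (~` (B `&` f @^-1` Z)); first by exists (B `&` f @^-1` Z).
  by rewrite setCI setIUl setICl set0U setIC.
have [[_ Ptriv _] Pinf Pblocks] := hP; have [_ Amem AD] := hA.
pose q Q := B `&` f @^-1` Q.
have qinf Q : P Q -> infinite_set (q Q).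
  move=> PQ fin; apply: (Pblocks Q PQ); apply: sub_finite_set (finite_image f fin).
  by move=> y Qy; have [x Bx fx] := fsurj y I; exists x => //; split; rewrite //= fx.
have /choice[c cP] (Q : set nat) : exists Y, P Q -> A Y /\ infinite_set (Y `&` q Q).
  have [PQ|nPQ] := pselect (P Q); last by exists set0.
  have /ideal_of_infinite_trace/(_ (qinf Q PQ))[Y AY YQ] : ideal_of A (q Q).
    exact/idealE/ideal_of_mem.
  by exists Y.
have /choice[H HP] (Q : set nat) : exists H, P Q ->
    [/\ H `<=` c Q `&` q Q, infinite_set H & infinite_set ((c Q `&` q Q) `\` H)].
  have [PQ|nPQ] := pselect (P Q); last by exists set0.
  by have [K ?] := infinite_split (cP Q PQ).2; exists K.
have meets_finitely Y : A Y -> finite_set [set Q | P Q /\ Y `&` q Q !=set0].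
  move=> AY; have /(ideal_of_partition _ hP) : ideal_of P (f @` (Y `&` B)).
    apply/idealE; apply: ideal_of_sub (ideal_of_mem AY) => x [Bx [y [Yy By] fxy]].
    by rewrite -(finj y x) ?in_setE.
  apply: sub_finite_set => Q [PQ [x [Yx [Bx Qfx]]]]; split=> //.
  by exists (f x); split=> //; exists x.
pose M := \bigcup_(Q in P) H Q.
have HM Q : P Q -> H Q `<=` M by move=> PQ; exact: bigcup_sup.
have [|Y AY YM] := hsep M.
  split=> [finM|fin].
    have [Q PQ] := infinite_setN0 Pinf; have [_ infH _] := HP Q PQ.
    exact/infH/(sub_finite_set (HM Q PQ)).
  apply: Pinf; apply: sub_finite_set (bigcup_finite fin (fun Y YS => meets_finitely Y YS.1)).
  move=> Q PQ; have [Hc infH _] := HP Q PQ; have [AcQ cQinf] := cP Q PQ.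
  exists (c Q); last by split=> //; exact: infinite_setN0.
  split=> //; apply: sub_infinite_set infH => x Hx.
  by split; [case: (Hc x Hx) | exact: HM Hx].
have [Q PQ YHinf] : exists2 Q, P Q & infinite_set (Y `&` H Q).
  apply: contrapT => noQ; apply: (Amem Y AY).
  apply: (@sub_finite_set _ _ (\bigcup_(Q in [set Q | P Q /\ Y `&` q Q !=set0]) (Y `&` H Q))).
    move=> x Yx; have [Q PQ HQx] := YM x Yx; exists Q => //; split=> //.
    by exists x; split=> //; have [/(_ x HQx)[]] := HP Q PQ.
  apply: bigcup_finite => [|Q [PQ _]]; first exact: meets_finitely.
  by apply: contrapT => ?; apply: noQ; exists Q.
have [Hc _ restinf] := HP Q PQ; have [AcQ _] := cP Q PQ.
have YcQ : Y = c Q.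
  apply: contrapT => YcQ; apply: YHinf; apply: sub_finite_set (AD _ _ AY AcQ YcQ).
  by move=> x [Yx /Hc[]].
apply: restinf; rewrite (_ : _ `\` _ = set0); first exact: finite_set0.
rewrite -subset0 => x [[cx [Bx Qfx]]]; apply.
rewrite -YcQ in cx; have [Q' PQ' HQ'x] := YM x cx.
have [/(_ x HQ'x)[_ [_ Q'fx]] _ _] := HP Q' PQ'.
by rewrite (Ptriv Q Q') //; exists (f x).
Qed.

Lemma partition_le_RK (P A : set_system nat) :
  partition_into_infinite_sets P -> AD_family A -> le_RK (filter_of P) (filter_of A).
Proof.
move=> hP hA; have [[Pcov Ptriv Pn0] Pinf _] := hP; have [Ainf Amem AD] := hA.
have [a aA ainj] : exists2 a : nat -> set nat, (forall n, A (a n)) & injective a.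
  move/infiniteP/pcard_leP: Ainf => [a]; exists a => [n|m n amn].
    exact: (@funS _ _ _ _ a n I).
  by apply: (@inj _ _ _ a); rewrite ?in_setT.
have [p [pP pinj psurj]] : exists p : nat -> set nat, set_bij setT P p.
  apply/card_set_bijP; rewrite card_eq_sym; apply: eq_card_nat => //.
  apply/countable_injP.
  have /choice[m mP] (Q : set nat) : exists m, P Q -> Q m.
    have [/Pn0[m Qm]|nPQ] := pselect (P Q); first by exists m.
    by exists 0.
  exists m => Q Q' /set_mem PQ /set_mem PQ' mQQ'; apply: Ptriv => //.
  by exists (m Q); split; [exact: mP | rewrite mQQ'; exact: mP].
have {}pP n : P (p n) by exact: pP.
pose inR x n := `[< a n x \/ x = n >].
have inRx x : exists n, inR x n by exists x; apply/asboolP; right.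
pose r x := ex_minn (inRx x).
have ra x : a (r x) x \/ x = r x.
  by rewrite /r; case: ex_minnP => n /asboolP.
have rinf n : infinite_set (r @^-1` [set n]).
  pose E := \bigcup_(m in `I_n) ((a n `&` a m) `|` [set m]).
  have finE : finite_set E.
    apply: bigcup_finite => [|m /= mn]; first exact: finite_II.
    rewrite finite_setU; split; last exact: finite_set1.
    by apply: AD => // /ainj nm; rewrite nm ltnn in mn.
  apply: sub_infinite_set (infinite_setD (Amem _ (aA n)) finE) => x [ax nEx] /=.
  rewrite /r; case: ex_minnP => m /asboolP mx mmin.
  have /mmin : inR x n by apply/asboolP; left.
  rewrite leq_eqVlt => /orP[/eqP//|mn]; case: nEx; exists m => //.
  by case: mx => [mx|->]; [left | right].
have /choice[g gP] (n : nat) := exists_infinite_fibers (rinf n) (Pn0 _ (pP n)).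
pose f x := g (r x) x.
have fp x : p (r x) (f x) by exact: (gP (r x)).1.
have fibre n y : p n y -> infinite_set (a n `&` f @^-1` [set y]).
  move=> pny fin; apply: ((gP n).2 y pny).
  apply: (@sub_finite_set _ _ ((a n `&` f @^-1` [set y]) `|` [set n])).
    move=> x [/= rx gx]; have := ra x; rewrite rx => -[ax|->]; last by right.
    by left; split=> //=; rewrite /f rx.
  by rewrite finite_setU; split=> //; exact: finite_set1.
have idealE Z : ideal_of A (f @^-1` Z) <-> ideal_of P Z.
  rewrite (ideal_of_partition _ hP); split=> [/(AD_ideal_finite_trace hA) fin|fin].
    have /(finite_image p) : finite_set (a @^-1` [set Y | A Y /\ infinite_set (Y `&` f @^-1` Z)]).
      by apply: finite_preimage fin => m n _ _; exact: ainj.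
    apply: sub_finite_set => Y [PY [y [Yy Zy]]].
    have [n _ pnY] := psurj Y PY; exists n => //=; split=> //.
    have : p n y by rewrite pnY.
    move/fibre; apply: sub_infinite_set => x [ax fx]; split=> //.
    by rewrite /= fx.
  have {}fin : finite_set [set n | p n `&` Z !=set0].
    apply: (@sub_finite_set _ _ (p @^-1` [set Y | P Y /\ Y `&` Z !=set0])).
      by move=> n ?; split.
    by apply: finite_preimage fin => m n _ _; apply: pinj; rewrite in_setT.
  exists (a @` [set n | p n `&` Z !=set0]); split=> [_ [n _ <-]||].
  - exact: aA.
  - exact: finite_image.
  apply: sub_finite_set fin => x [Zfx nx].
  have rxZ : p (r x) `&` Z !=set0 by exists (f x).
  have [ax|xr] := ra x; last by rewrite /= xr.
  by case: nx; exists (a (r x)) => //; exists (r x).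
exists f; split=> [y _|].
  have [Y PY Yy] : (\bigcup_(Y in P) Y) y by rewrite [\bigcup_(_ in _) _]Pcov.
  have [n _ pnY] := psurj Y PY; rewrite -pnY in Yy.
  by have [x [_ fx]] := infinite_setN0 (fibre n y Yy); exists x.
apply/predeqP => X; rewrite -[X in _ <-> filter_of P X]setCK filter_of_setC -idealE.
by rewrite -filter_of_setC preimage_setC setCK.
Qed.

Theorem corollary4p9 (P A : set_system nat)
  (hP : partition_into_infinite_sets P)
  (hA : NMAD_family A)
  (hsep : completely_separable A)
  (hsize : has_size_continuum A) :
  ~ le_TU (filter_of P) (filter_of A) /\ le_RK (filter_of P) (filter_of A).
Proof.
split; first exact: (partition_not_le_TU hP hA.1 hsep).
exact: (partition_le_RK hP hA.1).
Qed.
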